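(* Let $k$ be a field and let $V,W$ be finite dimensional $k$-linear spaces. (i) Let $H$ be a Hopf $k$-algebra whose square of the antipode is the identity, let $v\in\mathcal L(V)\otimes H$ be a corepresentation, and let $\pi:H\to\mathcal L(W)$ be a representation. Then $u:=(id\otimes\pi)v$ is invertible and satisfies $$(t\otimes id)u^{-1}=((t\otimes id)u)^{-1}.$$ (ii) Assume that $u\in\mathcal L(V)\otimes\mathcal L(W)$ is invertible and satisfies $(t\otimes id)u^{-1}=((t\otimes id)u)^{-1}$. If $(H,v,\pi)$ is the minimal model for $u$, then the square of the antipode of $H$ is the identity.
   Context: All $k$-algebras are unital with unital morphisms; all coalgebras are counital with counital morphisms. $\mathcal L(V)$ is the algebra of $k$-linear endomorphisms of $V$, tensor products are over $k$, and $t:\mathcal L(V)\to\mathcal L(V^* )$ is the transposition, $t(T)(f)=f\circ T$. The displayed equality takes place in $\mathcal L(V^* )\otimes\mathcal L(W)$ and includes the assertion that $(t\otimes id)u$ is invertible. Subscripts such as $v_{12},v_{13}$ are the usual leg-numbering notation. Let $H$ be a Hopf $k$-algebra with structure maps $\Delta,\varepsilon,S$. A (finite dimensional) representation of $H$ is a morphism of algebras $\pi:H\to\mathcal L(W)$. A (finite dimensional) corepresentation of $H$ is an element $v\in\mathcal L(V)\otimes H$ with $(id\otimes\Delta)v=v_{12}v_{13}$ and $(id\otimes\varepsilon)v=1$; its space of coefficients is $\mathcal C_v=\{(f\otimes id)v\mid f\in\mathcal L(V)^*\}\subset H$. For a subcoalgebra $C\subset H$, $\langle C\rangle$ is the unital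 subalgebra generated by $\bigcup_{k\ge0}S^k(C)$. A model for $u\in\mathcal L(V)\otimes\mathcal L(W)$ is a triple $(H,v,\pi)$ with $H$ a Hopf $k$-algebra, $v\in\mathcal L(V)\otimes H$ a corepresentation and $\pi:H\to\mathcal L(W)$ a representation such that $(id\otimes\pi)v=u$. It is left-faithful if $\langle\mathcal C_v\rangle=H$. A morphism of left-faithful models $(H_1,v_1,\pi_1)\to(H_2,v_2,\pi_2)$ of $u$ is a Hopf algebra morphism $f:H_1\to H_2$ with $(id\otimes f)v_1=v_2$ and $\pi_1=\pi_2f$. The minimal model for $u$ is the universally attracting (terminal) object of the category of left-faithful models for $u$. *)

(* Defs.v *)
From HB Require Import structures.
From mathcomp Require Import all_boot all_algebra.
From mathcomp Require Import boolp classical_sets.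

Set Implicit Arguments.
Unset Strict Implicit.
Unset Printing Implicit Defensive.

Import GRing.Theory.
Local Open Scope ring_scope.

(* MathComp's [algType] excludes the zero ring, but L(V) is the zero algebra   *)
(* when V = 0, so unital k-algebras are introduced here without [1 != 0].      *)
(* Hierarchy-Builder does not allow a new structure below both [pzRingType]    *)
(* and [lmodType k], hence the ring structure is derived after the fact.       *)
HB.mixin Record Lmodule_isPzAlgebra (k : pzRingType) A of GRing.Lmodule k A := {
  pzone : A;
  pzmul : A -> A -> A;
  pzmulA : associative pzmul;
  pzmul1r : left_id pzone pzmul;
  pzmulr1 : right_id pzone pzmul;
  pzmulDl : left_distributive pzmul +%R;
  pzmulDr : right_distributive pzmul +%R;
  pzscaler_mull : forall (a : k) x y, a *: pzmul x y = pzmul (a *: x) y;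
  pzscaler_mulr : forall (a : k) x y, a *: pzmul x y = pzmul x (a *: y)
}.

#[short(type="pzAlgType")]
HB.structure Definition PzAlgebra (k : pzRingType) :=
  {A of GRing.Lmodule k A & Lmodule_isPzAlgebra k A}.

HB.instance Definition _ (k : pzRingType) (A : pzAlgType k) :=
  GRing.Zmodule_isPzRing.Build (PzAlgebra.sort A)
    (@pzmulA k A) (@pzmul1r k A) (@pzmulr1 k A) (@pzmulDl k A) (@pzmulDr k A).

Lemma pzscalerAl (k : pzRingType) (A : pzAlgType k) (a : k) (x y : A) :
  a *: (x * y) = (a *: x) * y.
Proof. exact: pzscaler_mull. Qed.

Lemma pzscalerAr (k : pzRingType) (A : pzAlgType k) (a : k) (x y : A) :
  a *: (x * y) = x * (a *: y).
Proof. exact: pzscaler_mulr. Qed.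

HB.instance Definition _ (k : comNzRingType) :=
  Lmodule_isPzAlgebra.Build k k^o (@mulrA k) (@mul1r k) (@mulr1 k)
    (@mulrDl k) (@mulrDr k) (@mulrA k) (fun a x y => mulrCA a x y).

Definition alg_morphism (k : pzRingType) (A B : pzAlgType k) (f : A -> B) :=
  [/\ linear f, f 1 = 1 & {morph f : x y / x * y}].

Section Inverse.
Variable A : pzRingType.

Definition is_inverse (x y : A) := x * y = 1 /\ y * x = 1.
Definition invertible (x : A) := exists y, is_inverse x y.

(* Meaningful for invertible x only; the value is 0 otherwise. *)
Definition inverse (x : A) : A := xget 0 [set y | is_inverse x y]%classic.

Lemma is_inverse_inverse x : invertible x -> is_inverse x (inverse x).
Proof. by move=> [y xy]; rewrite /inverse; case: xgetP => [z _ //|/(_ y)/(_ xy)]. Qed.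

Lemma is_inverse_uniq x y z : is_inverse x y -> is_inverse x z -> y = z.
Proof. by move=> [_ yx] [xz _]; rewrite -[y]mulr1 -xz mulrA yx mul1r. Qed.

Lemma inverseE x y : is_inverse x y -> inverse x = y.
Proof.
move=> xy; have ix : invertible x by exists y.
exact: is_inverse_uniq (is_inverse_inverse ix) xy.
Qed.

End Inverse.

Section Tensor.
Variables (k : fieldType).
Implicit Types U V X : lmodType k.

Definition bilinear_map U V X (B : U -> V -> X) :=
  (forall v, linear (B^~ v)) /\ (forall u, linear (B u)).

Definition formal_sum U V X (B : U -> V -> X) (s : seq (U * V)) : X :=
  \sum_(p <- s) B p.1 p.2.

(* U ⊗ V is the set of formal sums of pairs (u, v), two of them being          *)
(* identified when they have the same image under every bilinear map into      *)
(* every k-module; see [tensor_universal].                                     *)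
Definition tensor_eq U V (s t : seq (U * V)) : bool :=
  `[< forall X (B : U -> V -> X),
        bilinear_map B -> formal_sum B s = formal_sum B t >].

Lemma tensor_eqP U V (s t : seq (U * V)) :
  reflect (forall X (B : U -> V -> X),
             bilinear_map B -> formal_sum B s = formal_sum B t) (tensor_eq s t).
Proof. exact: asboolP. Qed.

Lemma tensor_eq_refl U V : reflexive (@tensor_eq U V).
Proof. by move=> s; apply/tensor_eqP. Qed.

Lemma tensor_eq_sym U V : symmetric (@tensor_eq U V).
Proof.
by move=> s t; apply/idP/idP => /tensor_eqP st; apply/tensor_eqP => X B /st ->.
Qed.

Lemma tensor_eq_trans U V : transitive (@tensor_eq U V).
Proof.
move=> t s r /tensor_eqP st /tensor_eqP tr; apply/tensor_eqP => X B bB.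
by rewrite st ?tr.
Qed.

Canonical tensor_equiv U V :=
  EquivRel (@tensor_eq U V)
    (@tensor_eq_refl U V) (@tensor_eq_sym U V) (@tensor_eq_trans U V).

Definition tensor U V : Type := {eq_quot (@tensor_eq U V)}%qT.
HB.instance Definition _ U V := Choice.on (tensor U V).
HB.instance Definition _ U V := EqQuotient.on (tensor U V).

Definition tensor_pi U V (s : seq (U * V)) : tensor U V := (\pi s)%qT.

Definition pure U V (u : U) (v : V) : tensor U V := tensor_pi [:: (u, v)].

(* The linear map induced by B; meaningful for bilinear B only. *)
Definition tensor_lift U V X (B : U -> V -> X) (x : tensor U V) : X :=
  formal_sum B (repr x).

Section Module.
Variables U V : lmodType k.
Local Notation T := (tensor U V).
Local Notation pi := (@tensor_pi U V).

Lemma tensor_piP (s t : seq (U * V)) :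
  (forall X (B : U -> V -> X),
     bilinear_map B -> formal_sum B s = formal_sum B t) -> pi s = pi t.
Proof. by move=> st; apply/eqquotP/tensor_eqP. Qed.

Lemma tensor_lift_pi X (B : U -> V -> X) s :
  bilinear_map B -> tensor_lift B (pi s) = formal_sum B s.
Proof.
move=> bB; rewrite /tensor_lift.
have /eqquotP/tensor_eqP : (\pi_T (repr (pi s)) = \pi_T s)%qT by rewrite reprK.
exact.
Qed.

Lemma tensor_eq_lift (x y : T) :
  (forall X (B : U -> V -> X),
     bilinear_map B -> tensor_lift B x = tensor_lift B y) -> x = y.
Proof. by move=> xy; rewrite -[x]reprK -[y]reprK; apply: tensor_piP. Qed.

Definition tensor_zero : T := pi [::].
Definition tensor_add (x y : T) : T := pi (repr x ++ repr y).
Definition tensor_scale (a : k) (x : T) : T :=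
  pi [seq (a *: p.1, p.2) | p <- repr x].
Definition tensor_opp (x : T) : T := tensor_scale (-1) x.

Lemma formal_sum_cat X (B : U -> V -> X) s t :
  formal_sum B (s ++ t) = formal_sum B s + formal_sum B t.
Proof. exact: big_cat. Qed.

Lemma lift_zero X (B : U -> V -> X) :
  bilinear_map B -> tensor_lift B tensor_zero = 0.
Proof. by move=> bB; rewrite tensor_lift_pi // /formal_sum big_nil. Qed.

Lemma lift_add X (B : U -> V -> X) x y : bilinear_map B ->
  tensor_lift B (tensor_add x y) = tensor_lift B x + tensor_lift B y.
Proof. by move=> bB; rewrite tensor_lift_pi // formal_sum_cat. Qed.

Lemma lift_scale X (B : U -> V -> X) a x : bilinear_map B ->
  tensor_lift B (tensor_scale a x) = a *: tensor_lift B x.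
Proof.
move=> bB; rewrite tensor_lift_pi // /tensor_lift /formal_sum big_map scaler_sumr.
by apply: eq_bigr => p _ /=; rewrite (scalable_linear (bB.1 p.2)).
Qed.

Lemma lift_opp X (B : U -> V -> X) x : bilinear_map B ->
  tensor_lift B (tensor_opp x) = - tensor_lift B x.
Proof. by move=> bB; rewrite lift_scale // scaleN1r. Qed.

Lemma tensor_addA : associative tensor_add.
Proof. by move=> x y z; apply: tensor_eq_lift => X B bB; rewrite !lift_add // addrA. Qed.

Lemma tensor_addC : commutative tensor_add.
Proof. by move=> x y; apply: tensor_eq_lift => X B bB; rewrite !lift_add // addrC. Qed.

Lemma tensor_add0 : left_id tensor_zero tensor_add.
Proof.
by move=> x; apply: tensor_eq_lift => X B bB; rewrite lift_add // lift_zero // add0r.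
Qed.

Lemma tensor_addN : left_inverse tensor_zero tensor_opp tensor_add.
Proof.
move=> x; apply: tensor_eq_lift => X B bB.
by rewrite lift_add // lift_opp // lift_zero // addNr.
Qed.

HB.instance Definition _ :=
  GRing.isZmodule.Build T tensor_addA tensor_addC tensor_add0 tensor_addN.

Lemma tensor_scaleA a b x :
  tensor_scale a (tensor_scale b x) = tensor_scale (a * b) x.
Proof. by apply: tensor_eq_lift => X B bB; rewrite !lift_scale // scalerA. Qed.

Lemma tensor_scale1 : left_id 1 tensor_scale.
Proof. by move=> x; apply: tensor_eq_lift => X B bB; rewrite lift_scale // scale1r. Qed.

Lemma tensor_scaleDr : right_distributive tensor_scale +%R.
Proof.
move=> a x y; apply: tensor_eq_lift => X B bB.
by rewrite !(lift_scale, lift_add) // scalerDr.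
Qed.

Lemma tensor_scaleDl x : {morph tensor_scale^~ x : a b / a + b}.
Proof.
move=> a b; apply: tensor_eq_lift => X B bB.
by rewrite !(lift_scale, lift_add) // scalerDl.
Qed.

HB.instance Definition _ := GRing.Zmodule_isLmodule.Build k T
  tensor_scaleA tensor_scale1 tensor_scaleDr tensor_scaleDl.

Lemma tensor_lift_linear X (B : U -> V -> X) :
  bilinear_map B -> linear (tensor_lift B).
Proof. by move=> bB a x y; rewrite lift_add // lift_scale. Qed.

Lemma tensor_lift_pure X (B : U -> V -> X) u v :
  bilinear_map B -> tensor_lift B (pure u v) = B u v.
Proof. by move=> bB; rewrite tensor_lift_pi // /formal_sum big_seq1. Qed.

Lemma pure_bilinear : bilinear_map (@pure U V).
Proof.
split=> [v|u] a x y; apply: tensor_eq_lift => X B bB;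
  rewrite tensor_lift_linear // !tensor_lift_pure //; first exact: bB.1.
exact: bB.2.
Qed.

Lemma tensor_sum_pure (x : T) : exists s : seq (U * V),
  x = \sum_(p <- s) pure p.1 p.2.
Proof.
exists (repr x); rewrite -[LHS]reprK.
elim: (repr x) => [|p s IHs]; first by rewrite big_nil.
rewrite big_cons -IHs; apply: tensor_eq_lift => X B bB.
rewrite lift_add // tensor_lift_pure // !tensor_lift_pi //.
by rewrite /formal_sum big_cons.
Qed.

Lemma tensor_lift_sum X (B : U -> V -> X) (s : seq (U * V)) : bilinear_map B ->
  tensor_lift B (\sum_(p <- s) pure p.1 p.2) = \sum_(p <- s) B p.1 p.2.
Proof.
move=> bB.
have add : {morph tensor_lift B : x y / x + y} by move=> x y; apply: lift_add.
rewrite (big_morph _ add (lift_zero bB)).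
by apply: eq_bigr => p _; apply: tensor_lift_pure.
Qed.

Lemma linear_tensor_ext X (f g : T -> X) : linear f -> linear g ->
  (forall u v, f (pure u v) = g (pure u v)) -> f =1 g.
Proof.
move=> lf lg fg x; have [s ->] := tensor_sum_pure x.
pose f' : {linear T -> X} := HB.pack f (GRing.isLinear.Build k T X _ f lf).
pose g' : {linear T -> X} := HB.pack g (GRing.isLinear.Build k T X _ g lg).
rewrite -[LHS]/(f' _) -[RHS]/(g' _) !linear_sum.
by apply: eq_bigr => p _; apply: fg.
Qed.

Theorem tensor_universal X (B : U -> V -> X) : bilinear_map B ->
  exists2 f : T -> X, linear f /\ (forall u v, f (pure u v) = B u v)
    & forall g : T -> X, linear g -> (forall u v, g (pure u v) = B u v) ->
        g =1 f.
Proof.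
move=> bB; exists (tensor_lift B).
  split; first exact: tensor_lift_linear.
  by move=> u v; apply: tensor_lift_pure.
move=> g lg gB; apply: linear_tensor_ext => //; first exact: tensor_lift_linear.
by move=> u v; rewrite gB tensor_lift_pure.
Qed.

End Module.

(* f ⊗ g; meaningful for linear f and g only. *)
Definition tensor_map U V U' V' (f : U -> U') (g : V -> V') :
    tensor U V -> tensor U' V' :=
  tensor_lift (fun u v => pure (f u) (g v)).

Lemma tensor_map_bilinear U V U' V' (f : U -> U') (g : V -> V') :
  linear f -> linear g -> bilinear_map (fun u v => pure (f u) (g v)).
Proof.
move=> lf lg; have [pl pr] := pure_bilinear U' V'.
by split=> [v|u] a x y; rewrite ?lf ?lg; [apply: pl | apply: pr].
Qed.

Lemma tensor_map_linear U V U' V' (f : U -> U') (g : V -> V') :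
  linear f -> linear g -> linear (tensor_map f g).
Proof. by move=> lf lg; apply/tensor_lift_linear/tensor_map_bilinear. Qed.

Lemma tensor_map_pure U V U' V' (f : U -> U') (g : V -> V') u v :
  linear f -> linear g -> tensor_map f g (pure u v) = pure (f u) (g v).
Proof.
by move=> lf lg; rewrite /tensor_map tensor_lift_pure //; apply: tensor_map_bilinear.
Qed.

Definition tensor_assoc U V X :
    tensor (tensor U V) X -> tensor U (tensor V X) :=
  tensor_lift (fun y w => tensor_lift (fun u v => pure u (pure v w)) y).

Definition tensor_unitl V : tensor k^o V -> V :=
  tensor_lift (fun (a : k^o) v => (a : k) *: v).

Definition tensor_unitr V : tensor V k^o -> V :=
  tensor_lift (fun v (a : k^o) => (a : k) *: v).

Lemma tensor_assoc_aux U V X (w : X) :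
  bilinear_map (fun (u : U) (v : V) => pure u (pure v w)).
Proof.
have [pl pr] := pure_bilinear U (tensor V X); have [ql _] := pure_bilinear V X.
by split=> [v|u] a x y; rewrite ?ql; [apply: pl | apply: pr].
Qed.

Lemma tensor_assoc_bilinear U V X : bilinear_map
  (fun y (w : X) => tensor_lift (fun (u : U) (v : V) => pure u (pure v w)) y).
Proof.
split=> [w|y] a x z; first exact/tensor_lift_linear/tensor_assoc_aux.
have [s ->] := tensor_sum_pure y.
rewrite (tensor_lift_sum s (tensor_assoc_aux _ _ (a *: x + z))).
rewrite (tensor_lift_sum s (tensor_assoc_aux _ _ x)).
rewrite (tensor_lift_sum s (tensor_assoc_aux _ _ z)).
rewrite scaler_sumr -big_split /=; apply: eq_bigr => p _.
by rewrite (pure_bilinear V X).2 (pure_bilinear U (tensor V X)).2.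
Qed.

Lemma tensor_assoc_pure U V X (u : U) (v : V) (w : X) :
  tensor_assoc (pure (pure u v) w) = pure u (pure v w).
Proof.
rewrite /tensor_assoc tensor_lift_pure; last exact: tensor_assoc_bilinear.
by rewrite tensor_lift_pure //; apply: tensor_assoc_aux.
Qed.

Lemma tensor_unitl_pure V a (v : V) :
  tensor_unitl (pure (a : k^o) v) = a *: v.
Proof.
rewrite /tensor_unitl tensor_lift_pure //; split=> [w|b] c x y.
  by rewrite scalerDl scalerA.
by rewrite scalerDr !scalerA mulrC.
Qed.

Lemma tensor_unitr_pure V a (v : V) :
  tensor_unitr (pure v (a : k^o)) = a *: v.
Proof.
rewrite /tensor_unitr tensor_lift_pure //; split=> [b|w] c x y.
  by rewrite scalerDr !scalerA mulrC.
by rewrite scalerDl scalerA.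
Qed.

End Tensor.

Declare Scope tensor_scope.
Delimit Scope tensor_scope with tens.
Notation "U ⊗ V" := (tensor U V) (at level 40, left associativity) : type_scope.
Notation "u ⊗ v" := (pure u v) (at level 40, left associativity) : ring_scope.
Notation "f ⊗ g" := (tensor_map f g) (at level 40, left associativity) :
  tensor_scope.

Section TensorAlgebra.
Variables (k : fieldType) (A B : pzAlgType k).
Local Notation T := (A ⊗ B)%type.

Definition tensor_one : T := (1 : A) ⊗ (1 : B).

(* (a ⊗ b) (a' ⊗ b') = a a' ⊗ b b', see [tensor_mul_pure]. *)
Definition tensor_mul (x y : T) : T :=
  tensor_lift (fun (a : A) (b : B) =>
    tensor_lift (fun (a' : A) (b' : B) => (a * a') ⊗ (b * b')) y) x.

Lemma pz_mull_linear (C : pzAlgType k) (c : C) : linear (fun x : C => c * x).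
Proof. by move=> a x y; rewrite mulrDr pzscalerAr. Qed.

Lemma pz_mulr_linear (C : pzAlgType k) (c : C) : linear (fun x : C => x * c).
Proof. by move=> a x y; rewrite mulrDl pzscalerAl. Qed.

Lemma tensor_mul_auxr a b :
  bilinear_map (fun (a' : A) (b' : B) => (a * a') ⊗ (b * b')).
Proof. by apply: tensor_map_bilinear; apply: pz_mull_linear. Qed.

Lemma tensor_mul_auxl (y : T) : bilinear_map
  (fun (a : A) (b : B) =>
     tensor_lift (fun (a' : A) (b' : B) => (a * a') ⊗ (b * b')) y).
Proof.
have [s ->] := tensor_sum_pure y.
have liftE (a : A) (b : B) : tensor_lift (fun (a' : A) (b' : B) => (a * a') ⊗ (b * b'))
    (\sum_(p <- s) p.1 ⊗ p.2) = \sum_(p <- s) (a * p.1) ⊗ (b * p.2) :> T.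
  by rewrite tensor_lift_sum //; apply: tensor_mul_auxr.
split=> [b|a] c x z; rewrite !liftE scaler_sumr -big_split /=;
  apply: eq_bigr => p _; rewrite mulrDl -pzscalerAl.
  exact: (pure_bilinear A B).1.
exact: (pure_bilinear A B).2.
Qed.

Lemma tensor_mul_pure (a a' : A) (b b' : B) :
  tensor_mul (a ⊗ b) (a' ⊗ b') = (a * a') ⊗ (b * b').
Proof.
rewrite /tensor_mul tensor_lift_pure; last exact: tensor_mul_auxl.
by rewrite tensor_lift_pure //; apply: tensor_mul_auxr.
Qed.

Lemma tensor_mul_linl y : linear (tensor_mul^~ y).
Proof. exact/tensor_lift_linear/tensor_mul_auxl. Qed.

Lemma tensor_mul_linr x : linear (tensor_mul x).
Proof.
move=> c y z; have [s ->] := tensor_sum_pure x.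
have mulE t : tensor_mul (\sum_(p <- s) p.1 ⊗ p.2) t =
    \sum_(p <- s) tensor_lift (fun (a' : A) (b' : B) => (p.1 * a') ⊗ (p.2 * b')) t.
  by rewrite /tensor_mul tensor_lift_sum //; apply: tensor_mul_auxl.
rewrite !mulE scaler_sumr -big_split /=; apply: eq_bigr => p _.
exact/tensor_lift_linear/tensor_mul_auxr.
Qed.

Lemma tensor_mulDl : left_distributive tensor_mul +%R.
Proof. by move=> x y z; have := tensor_mul_linl z 1 x y; rewrite !scale1r. Qed.

Lemma tensor_mulDr : right_distributive tensor_mul +%R.
Proof. by move=> x y z; have := tensor_mul_linr x 1 y z; rewrite !scale1r. Qed.

Lemma tensor_mul1 : left_id tensor_one tensor_mul.
Proof.
move=> x; apply: (@linear_tensor_ext _ _ _ _ (tensor_mul tensor_one) idfun) => //.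
  exact: tensor_mul_linr.
by move=> a b; rewrite tensor_mul_pure !mul1r.
Qed.

Lemma tensor_mulr1 : right_id tensor_one tensor_mul.
Proof.
move=> x; apply: (@linear_tensor_ext _ _ _ _ (tensor_mul^~ tensor_one) idfun) => //.
  exact: tensor_mul_linl.
by move=> a b; rewrite tensor_mul_pure !mulr1.
Qed.

Lemma tensor_mulA : associative tensor_mul.
Proof.
move=> x y z; move: x; apply: linear_tensor_ext.
- exact: tensor_mul_linl.
- by move=> c u v; rewrite !tensor_mul_linl.
move=> a b; move: y; apply: linear_tensor_ext.
- by move=> c u v; rewrite tensor_mul_linl tensor_mul_linr.
- by move=> c u v; rewrite tensor_mul_linr tensor_mul_linl.
move=> a' b'; move: z; apply: linear_tensor_ext.
- by move=> c u v; rewrite !tensor_mul_linr.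
- exact: tensor_mul_linr.
by move=> a'' b''; rewrite !tensor_mul_pure !mulrA.
Qed.

Lemma tensor_scaleAl c x y : c *: tensor_mul x y = tensor_mul (c *: x) y.
Proof.
have y0 : tensor_mul 0 y = 0 by exact: lift_zero (tensor_mul_auxl y).
by have := tensor_mul_linl y c x 0; rewrite y0 !addr0.
Qed.

Lemma tensor_scaleAr c x y : c *: tensor_mul x y = tensor_mul x (c *: y).
Proof.
have x0 : tensor_mul x 0 = 0.
  by apply: (addIr (tensor_mul x 0)); rewrite -tensor_mulDr !add0r.
by have := tensor_mul_linr x c y 0; rewrite x0 !addr0.
Qed.

HB.instance Definition _ := Lmodule_isPzAlgebra.Build k T
  tensor_mulA tensor_mul1 tensor_mulr1 tensor_mulDl tensor_mulDr
  tensor_scaleAl tensor_scaleAr.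
HB.instance Definition _ := GRing.PzRing.copy T (PzAlgebra.sort T).

End TensorAlgebra.

Section Endomorphisms.
Variables (k : fieldType).

(* L(V); an alias, because MathComp puts no ring structure on 'End(V).        *)
Definition endo (V : vectType k) : Type := 'End(V).
HB.instance Definition _ (V : vectType k) := Vector.on (endo V).

Definition dual (V : vectType k) : vectType k := 'Hom(V, k^o).

Section Ring.
Variable V : vectType k.

Definition endo_mul (f g : endo V) : endo V := (f \o g)%VF.

Lemma endo_mulA : associative endo_mul.
Proof. by move=> f g h; apply: comp_lfunA. Qed.

Lemma endo_mul1 : left_id (\1%VF : endo V) endo_mul.
Proof. by move=> f; apply: comp_lfun1l. Qed.

Lemma endo_mulr1 : right_id (\1%VF : endo V) endo_mul.
Proof. by move=> f; apply: comp_lfun1r. Qed.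

Lemma endo_mulDl : left_distributive endo_mul +%R.
Proof. by move=> f g h; apply: comp_lfunDl. Qed.

Lemma endo_mulDr : right_distributive endo_mul +%R.
Proof. by move=> f g h; apply: comp_lfunDr. Qed.

Lemma endo_scaleAl c f g : c *: endo_mul f g = endo_mul (c *: f) g.
Proof. exact: comp_lfunZl. Qed.

Lemma endo_scaleAr c f g : c *: endo_mul f g = endo_mul f (c *: g).
Proof. exact: comp_lfunZr. Qed.

HB.instance Definition _ := Lmodule_isPzAlgebra.Build k (endo V)
  endo_mulA endo_mul1 endo_mulr1 endo_mulDl endo_mulDr
  endo_scaleAl endo_scaleAr.
HB.instance Definition _ := GRing.PzRing.copy (endo V) (PzAlgebra.sort (endo V)).

End Ring.

Definition transpose (V : vectType k) (T : endo V) : endo (dual V) :=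
  linfun (fun f : dual V => (f \o T)%VF : dual V).

Lemma transposeE (V : vectType k) (T : endo V) (f : dual V) :
  (transpose T : 'End(dual V)) f = (f \o T)%VF.
Proof.
pose F (f : dual V) : dual V := (f \o T)%VF.
have lF : linear F by move=> a x y; rewrite /F comp_lfunDl comp_lfunZl.
pose F' : {linear dual V -> dual V} := HB.pack F (GRing.isLinear.Build k _ _ _ F lF).
exact: (lfunE F').
Qed.

Lemma transpose_linear (V : vectType k) : linear (@transpose V).
Proof.
move=> a S T; apply/lfunP => f.
transitivity (a *: (transpose S : 'End(dual V)) f + (transpose T : 'End(dual V)) f).
  rewrite !transposeE; apply/lfunP => w.
  by rewrite add_lfunE scale_lfunE !comp_lfunE /= [(a *: S + T) w]add_lfunE
    [(a *: S) w]scale_lfunE linearD linearZ.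
by symmetry; etransitivity; [apply: add_lfunE | congr (_ + _); apply: scale_lfunE].
Qed.

End Endomorphisms.

Definition tensor_multiply (k : fieldType) (A : pzAlgType k) : (A ⊗ A)%type -> A :=
  tensor_lift (fun a b : A => a * b).

Record hopfAlgType (k : fieldType) := HopfAlgType {
  hopf_alg :> pzAlgType k;
  comul : hopf_alg -> (hopf_alg ⊗ hopf_alg)%type;
  counit : hopf_alg -> k^o;
  antipode : hopf_alg -> hopf_alg;
  comul_alg : alg_morphism comul;
  counit_alg : alg_morphism counit;
  antipode_linear : linear antipode;
  comulA : forall x,
    tensor_assoc ((comul ⊗ idfun)%tens (comul x)) = (idfun ⊗ comul)%tens (comul x);
  counitl : forall x, tensor_unitl ((counit ⊗ idfun)%tens (comul x)) = x;
  counitr : forall x, tensor_unitr ((idfun ⊗ counit)%tens (comul x)) = x;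
  antipodel : forall x,
    tensor_multiply ((antipode ⊗ idfun)%tens (comul x)) = (counit x : k) *: (1 : hopf_alg);
  antipoder : forall x,
    tensor_multiply ((idfun ⊗ antipode)%tens (comul x)) = (counit x : k) *: (1 : hopf_alg)
}.

Section Representations.
Variables (k : fieldType) (V W : vectType k).

Definition hopf_morphism (H1 H2 : hopfAlgType k) (f : H1 -> H2) :=
  [/\ alg_morphism f,
      forall x, comul (f x) = (f ⊗ f)%tens (comul x),
      forall x, counit (f x) = counit x
    & forall x, antipode (f x) = f (antipode x)].

Variable H : hopfAlgType k.

Definition representation (pi : H -> endo W) := alg_morphism pi.

(* Leg numbering in L(V) ⊗ (H ⊗ H). *)
Definition leg12 (v : (endo V ⊗ H)%type) : (endo V ⊗ (H ⊗ H))%type :=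
  (idfun ⊗ (fun h : H => pure h (1 : H)))%tens v.
Definition leg13 (v : (endo V ⊗ H)%type) : (endo V ⊗ (H ⊗ H))%type :=
  (idfun ⊗ (fun h : H => pure (1 : H) h))%tens v.

Definition corepresentation (v : (endo V ⊗ H)%type) :=
  (idfun ⊗ @comul k H)%tens v = leg12 v * leg13 v /\
  tensor_unitr ((idfun ⊗ @counit k H)%tens v) = 1.

Definition coefficients (v : (endo V ⊗ H)%type) : set H :=
  [set h | exists2 f : endo V -> k^o,
     linear f & h = tensor_unitl ((f ⊗ idfun)%tens v)]%classic.

Definition subalgebra (S : set H) :=
  [/\ S 1,
      forall (a : k) x y, S x -> S y -> S (a *: x + y)
    & forall x y, S x -> S y -> S (x * y)].

(* <C>, the unital subalgebra generated by the S^n(C), n >= 0. *)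
Definition generated_hopf (C : set H) : set H :=
  smallest subalgebra (\bigcup_n (iter n (@antipode k H) @` C))%classic.

End Representations.

Section Models.
Variables (k : fieldType) (V W : vectType k).

Record model (u : (endo V ⊗ endo W)%type) := Model {
  model_hopf : hopfAlgType k;
  model_corep : (endo V ⊗ model_hopf)%type;
  model_rep : model_hopf -> endo W;
  model_corepP : corepresentation model_corep;
  model_repP : representation model_rep;
  modelP : (idfun ⊗ model_rep)%tens model_corep = u
}.
Arguments model_rep {u} m _.

Variable u : (endo V ⊗ endo W)%type.

Definition left_faithful (M : model u) :=
  generated_hopf (coefficients (model_corep M)) = [set: model_hopf M]%classic.

Definition model_morphism (M1 M2 : model u)
    (f : model_hopf M1 -> model_hopf M2) :=
  [/\ hopf_morphism f,
      (idfun ⊗ f)%tens (model_corep M1) = model_corep M2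
    & model_rep M1 =1 model_rep M2 \o f].

Definition minimal_model (M : model u) :=
  left_faithful M /\
  forall M' : model u, left_faithful M' ->
    exists! f : model_hopf M' -> model_hopf M, model_morphism f.

(* (t ⊗ id) u^-1 = ((t ⊗ id) u)^-1, both inverses being required to exist. *)
Definition transpose_inverse :=
  [/\ invertible u,
      invertible ((@transpose k V ⊗ idfun)%tens u)
    & (@transpose k V ⊗ idfun)%tens (inverse u) =
      inverse ((@transpose k V ⊗ idfun)%tens u)].

End Models.

(* Main.v *)
Require Import Defs.
From HB Require Import structures.
From mathcomp Require Import all_boot all_algebra.
From mathcomp Require Import boolp classical_sets.

Set Implicit Arguments.
Unset Strict Implicit.
Unset Printing Implicit Defensive.

Import GRing.Theory.
Local Open Scope ring_scope.

(** Write [S] for the antipode and [t] for transposition. For a fixed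
    corepresentation [v], the assignment [f |-> (id ⊗ f) v] turns the convolution
    product of linear maps [f : H -> A] into the product of [L(V) ⊗ A]
    ([corep_conv]). An algebra morphism [p] has convolution inverse [p \o S], so
    [u = (id ⊗ p) v] is invertible with inverse [(id ⊗ p S) v]
    ([corep_inverse]). Both [t] and [S] reverse products, hence so does [t ⊗ S];
    applied to the inverse pair [v], [(id ⊗ S) v], it shows that
    [(t ⊗ p S) v = (t ⊗ id) u^-1] has inverse [(t ⊗ p S S) v]
    ([transpose_corep_inverse]). If [S S = id] that inverse is [(t ⊗ id) u],
    which is part (i).

    Conversely, if [(t ⊗ id) u] is the inverse of [(t ⊗ id) u^-1], uniqueness of
    inverses and injectivity of [t] give [(id ⊗ p S S) v = u]
    ([transpose_inverse_antipode2]): replacing the representation [p] by [p S S]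
    gives another left-faithful model with the same Hopf algebra and the same
    corepresentation. A morphism from it to the minimal model fixes the
    coefficients of [v] and commutes with [S], so it is the identity and
    [p S S = p] ([minimal_rep_antipode2]). The two-sided ideal [J] generated by
    the elements [S (S x) - x] is a Hopf ideal, because [S S] is a Hopf algebra endomorphism,
    and it lies in the kernel of [p]. So [H / J], whose antipode squares to the
    identity, carries a left-faithful model of [u]. Terminality provides a Hopf
    algebra morphism [H / J -> H] fixing the coefficients of the
    corepresentations; since these and their images under powers of [S] generate
    [H], it is surjective, and [S S = id] passes from [H / J] to [H]
    ([minimal_antipode2]).

    That [S] reverses products and coproducts is obtained from uniqueness of
    inverses and cancellation in convolution algebras ([antipodeM],
    [comul_antipode]). *)

(** * Linear maps and tensor products *)

Section LinearMaps.
Variable k : fieldType.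
Implicit Types U V W X : lmodType k.

Lemma linear_idfun U : linear (idfun : U -> U).
Proof. by []. Qed.

Lemma linear_comp U V X (g : V -> X) (f : U -> V) :
  linear g -> linear f -> linear (g \o f).
Proof. by move=> lg lf a x y; rewrite /= lf lg. Qed.

Section Additivity.
Variables (U V : lmodType k) (f : U -> V).
Hypothesis lf : linear f.

Let f' : {linear U -> V} := HB.pack f (GRing.isLinear.Build k U V _ f lf).

Lemma linear_map0 : f 0 = 0.
Proof. exact: (linear0 f'). Qed.

Lemma linear_mapB x y : f (x - y) = f x - f y.
Proof. exact: (linearB f'). Qed.

Lemma linear_mapZ a x : f (a *: x) = a *: f x.
Proof. exact: (linearZ_LR f'). Qed.

Lemma linear_map_sum (I : Type) (s : seq I) (F : I -> U) :
  f (\sum_(i <- s) F i) = \sum_(i <- s) f (F i).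
Proof. exact: (linear_sum f'). Qed.

End Additivity.

Lemma linear_scaler X (x : X) : linear (fun a : k^o => (a : k) *: x).
Proof. by move=> a b c; rewrite scalerDl scalerA. Qed.

Lemma linear_bigsum U V (I : Type) (s : seq I) (F : I -> U -> V) :
  (forall i, linear (F i)) -> linear (fun x => \sum_(i <- s) F i x).
Proof.
move=> lF a x y; rewrite scaler_sumr -big_split.
by apply: eq_bigr => i _; apply: lF.
Qed.

Lemma pure_linearl U V (v : V) : linear (fun u : U => u ⊗ v).
Proof. exact: (pure_bilinear U V).1. Qed.

Lemma pure_linearr U V (u : U) : linear (fun v : V => u ⊗ v).
Proof. exact: (pure_bilinear U V).2. Qed.

Lemma tensor_unitl_linear X : linear (@tensor_unitl k X).
Proof.
apply: tensor_lift_linear; split=> [v|a] b x y; first exact: linear_scaler.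
by rewrite scalerDr !scalerA mulrC.
Qed.

Lemma tensor_unitr_linear X : linear (@tensor_unitr k X).
Proof.
apply: tensor_lift_linear; split=> [a|v] b x y; last exact: linear_scaler.
by rewrite scalerDr !scalerA mulrC.
Qed.

Lemma tensor_assoc_linear U V X : linear (@tensor_assoc k U V X).
Proof. exact/tensor_lift_linear/tensor_assoc_bilinear. Qed.

Lemma tensor_map_comp U V U' V' U'' V'' (f' : U' -> U'') (g' : V' -> V'')
    (f : U -> U') (g : V -> V') x :
  linear f' -> linear g' -> linear f -> linear g ->
  (f' ⊗ g')%tens ((f ⊗ g)%tens x) = ((f' \o f) ⊗ (g' \o g))%tens x.
Proof.
move=> lf' lg' lf lg; move: x; apply: linear_tensor_ext.
- by apply: (@linear_comp _ _ _ (f' ⊗ g')%tens); apply: tensor_map_linear.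
- by apply: tensor_map_linear; apply: linear_comp.
move=> u v; rewrite !tensor_map_pure //; exact: linear_comp.
Qed.

Lemma tensor_map_id U V (x : (U ⊗ V)%type) : (idfun ⊗ idfun)%tens x = x.
Proof.
move: x; apply: (@linear_tensor_ext k U V _ (idfun ⊗ idfun)%tens idfun) => //.
  exact: tensor_map_linear.
by move=> u v; rewrite tensor_map_pure.
Qed.

Lemma tensor_assoc_map U V W U' V' W' (f : U -> U') (g : V -> V') (h : W -> W')
    (x : ((U ⊗ V) ⊗ W)%type) :
  linear f -> linear g -> linear h ->
  tensor_assoc (((f ⊗ g) ⊗ h)%tens x) = (f ⊗ (g ⊗ h))%tens (tensor_assoc x).
Proof.
move=> lf lg lh; have lfg := tensor_map_linear lf lg.
have lgh := tensor_map_linear lg lh.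
have lL := linear_comp (@tensor_assoc_linear U' V' W') (tensor_map_linear lfg lh).
have lR := linear_comp (tensor_map_linear lf lgh) (@tensor_assoc_linear U V W).
move: x; apply: (linear_tensor_ext lL lR) => y w /=.
move: y; apply: linear_tensor_ext.
- exact: (linear_comp lL (@pure_linearl _ _ w)).
- exact: (linear_comp lR (@pure_linearl _ _ w)).
by move=> u v /=; rewrite !(tensor_map_pure, tensor_assoc_pure).
Qed.

End LinearMaps.

(** * Algebra morphisms *)

Section AlgebraMorphisms.
Variable k : fieldType.
Implicit Types A B C : pzAlgType k.

Lemma alg_morphism_id A : alg_morphism (idfun : A -> A).
Proof. by []. Qed.

Lemma alg_morphism_comp A B C (g : B -> C) (f : A -> B) :
  alg_morphism g -> alg_morphism f -> alg_morphism (g \o f).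
Proof.
move=> [lg g1 gM] [lf f1 fM]; split=> [|/=|x y /=]; first exact: linear_comp.
  by rewrite f1.
by rewrite fM gM.
Qed.

Lemma tensor_map_mul A B A' B' (f : A -> A') (g : B -> B') :
  alg_morphism f -> alg_morphism g -> alg_morphism (f ⊗ g)%tens.
Proof.
move=> [lf f1 fM] [lg g1 gM]; have lfg := tensor_map_linear lf lg.
split=> // [|x y]; first by rewrite [LHS]tensor_map_pure // f1 g1.
have lm (C : pzAlgType k) (c : C) := pz_mull_linear c.
have rm (C : pzAlgType k) (c : C) := pz_mulr_linear c.
move: x; apply: linear_tensor_ext.
- exact: (linear_comp lfg (rm _ y)).
- exact: (linear_comp (rm _ _) lfg).
move=> a b; move: y; apply: linear_tensor_ext.
- exact: (linear_comp lfg (lm _ (a ⊗ b))).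
- exact: (linear_comp (lm _ _) lfg).
move=> a' b'; rewrite !tensor_map_pure // [a ⊗ b * _]tensor_mul_pure.
by rewrite [RHS]tensor_mul_pure tensor_map_pure // fM gM.
Qed.

Lemma tensor_map_antimul A B A' B' (f : A -> A') (g : B -> B') :
  linear f -> linear g ->
  (forall x y, f (x * y) = f y * f x) -> (forall x y, g (x * y) = g y * g x) ->
  forall x y, (f ⊗ g)%tens (x * y) = (f ⊗ g)%tens y * (f ⊗ g)%tens x.
Proof.
move=> lf lg fM gM x y; have lfg := tensor_map_linear lf lg.
have lm (C : pzAlgType k) (c : C) := pz_mull_linear c.
have rm (C : pzAlgType k) (c : C) := pz_mulr_linear c.
move: x; apply: linear_tensor_ext.
- exact: (linear_comp lfg (rm _ y)).
- exact: (linear_comp (lm _ _) lfg).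
move=> a b; move: y; apply: linear_tensor_ext.
- exact: (linear_comp lfg (lm _ (a ⊗ b))).
- exact: (linear_comp (rm _ _) lfg).
move=> a' b'; rewrite !tensor_map_pure // [a ⊗ b * _]tensor_mul_pure.
by rewrite [RHS]tensor_mul_pure tensor_map_pure // fM gM.
Qed.

Lemma is_inverse_sym A (x y : A) : is_inverse x y -> is_inverse y x.
Proof. by case. Qed.

Lemma tensor_multiply_bilinear A : bilinear_map (fun a b : A => a * b).
Proof. by split=> c; [apply: pz_mulr_linear | apply: pz_mull_linear]. Qed.

Lemma tensor_multiply_linear A : linear (@tensor_multiply k A).
Proof. exact/tensor_lift_linear/tensor_multiply_bilinear. Qed.

Lemma tensor_multiply_pure A (a b : A) : tensor_multiply (a ⊗ b) = a * b.
Proof. exact/tensor_lift_pure/tensor_multiply_bilinear. Qed.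

Lemma tensor_multiplyA A (y : ((A ⊗ A) ⊗ A)%type) :
  tensor_multiply ((@tensor_multiply k A ⊗ idfun)%tens y) =
  tensor_multiply ((idfun ⊗ @tensor_multiply k A)%tens (tensor_assoc y)).
Proof.
have lm := @tensor_multiply_linear A; have lid := @linear_idfun k A.
have lL := linear_comp lm (tensor_map_linear lm lid).
have lR := linear_comp lm (linear_comp (tensor_map_linear lid lm)
  (@tensor_assoc_linear k A A A)).
move: y; apply: (linear_tensor_ext lL lR) => y c; move: y; apply: linear_tensor_ext.
- exact: (linear_comp lL (@pure_linearl _ _ _ c)).
- exact: (linear_comp lR (@pure_linearl _ _ _ c)).
move=> a b /=; rewrite tensor_assoc_pure !tensor_map_pure //.
by rewrite !tensor_multiply_pure mulrA.
Qed.

End AlgebraMorphisms.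

(** * The convolution algebra *)

Section Convolution.
Variables (k : fieldType) (H : hopfAlgType k).

Lemma comul_linear : linear (@comul k H). Proof. by case: (comul_alg H). Qed.
Lemma counit_linear : linear (@counit k H). Proof. by case: (counit_alg H). Qed.

Section Monoid.
Variable A : pzAlgType k.
Implicit Types f g h : H -> A.

Definition conv f g (x : H) : A := tensor_multiply ((f ⊗ g)%tens (comul x)).
Definition conv_one (x : H) : A := (counit x : k) *: (1 : A).

Lemma conv_one_linear : linear conv_one.
Proof. exact: (linear_comp (@linear_scaler k _ (1 : A)) counit_linear). Qed.

Lemma conv_linear f g : linear f -> linear g -> linear (conv f g).
Proof.
move=> lf lg.
exact: (linear_comp (@tensor_multiply_linear k A)
  (linear_comp (tensor_map_linear lf lg) comul_linear)).
Qed.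

Lemma conv_sum f g x (s : seq (H * H)) : linear f -> linear g ->
  comul x = \sum_(p <- s) p.1 ⊗ p.2 ->
  conv f g x = \sum_(p <- s) f p.1 * g p.2.
Proof.
move=> lf lg xs; rewrite /conv xs.
rewrite (linear_map_sum (tensor_map_linear lf lg)).
rewrite (linear_map_sum (@tensor_multiply_linear k A)).
by apply: eq_bigr => p _; rewrite tensor_map_pure // tensor_multiply_pure.
Qed.

Lemma convA f g h : linear f -> linear g -> linear h ->
  conv (conv f g) h = conv f (conv g h).
Proof.
move=> lf lg lh; apply/funext => x.
have lid := @linear_idfun k H; have lmA := @tensor_multiply_linear k A.
have lfg := tensor_map_linear lf lg; have lgh := tensor_map_linear lg lh.
rewrite /conv.
transitivity (tensor_multiply ((@tensor_multiply k A ⊗ idfun)%tens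
    (((f ⊗ g) ⊗ h)%tens ((@comul k H ⊗ idfun)%tens (comul x))))).
  by rewrite !tensor_map_comp //; do ?[exact: comul_linear | exact: linear_comp].
transitivity (tensor_multiply ((idfun ⊗ @tensor_multiply k A)%tens
    ((f ⊗ (g ⊗ h))%tens ((idfun ⊗ @comul k H)%tens (comul x))))); last first.
  by rewrite !tensor_map_comp //; do ?[exact: comul_linear | exact: linear_comp].
rewrite -comulA -tensor_assoc_map //.
exact: tensor_multiplyA.
Qed.

Lemma conv1f f : linear f -> conv conv_one f = f.
Proof.
move=> lf; apply/funext => x; have [s xs] := tensor_sum_pure (comul x).
rewrite (conv_sum conv_one_linear lf xs) -[in RHS](counitl x) xs.
have lid := @linear_idfun k H; have le := counit_linear.
rewrite (linear_map_sum (tensor_map_linear le lid)).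
rewrite (linear_map_sum (@tensor_unitl_linear k H)) (linear_map_sum lf).
apply: eq_bigr => p _; rewrite tensor_map_pure // tensor_unitl_pure.
by rewrite (linear_mapZ lf) -pzscalerAl mul1r.
Qed.

Lemma convf1 f : linear f -> conv f conv_one = f.
Proof.
move=> lf; apply/funext => x; have [s xs] := tensor_sum_pure (comul x).
rewrite (conv_sum lf conv_one_linear xs) -[in RHS](counitr x) xs.
have lid := @linear_idfun k H; have le := counit_linear.
rewrite (linear_map_sum (tensor_map_linear lid le)).
rewrite (linear_map_sum (@tensor_unitr_linear k H)) (linear_map_sum lf).
apply: eq_bigr => p _; rewrite tensor_map_pure // tensor_unitr_pure.
by rewrite (linear_mapZ lf) -pzscalerAr mulr1.
Qed.

Lemma conv_inverse_uniq f g h : linear f -> linear g -> linear h ->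
  conv f g = conv_one -> conv g h = conv_one -> f = h.
Proof.
by move=> lf lg lh fg gh; rewrite -(convf1 lf) -gh -convA // fg conv1f.
Qed.

End Monoid.

Lemma conv_post (A B : pzAlgType k) (p : A -> B) (f g : H -> A) :
  alg_morphism p -> linear f -> linear g ->
  p \o conv f g = conv (p \o f) (p \o g).
Proof.
move=> [lp _ pM] lf lg; apply/funext => x /=.
have [s xs] := tensor_sum_pure (comul x).
rewrite (conv_sum lf lg xs) (linear_map_sum lp).
rewrite (conv_sum (linear_comp lp lf) (linear_comp lp lg) xs).
by apply: eq_bigr => i _; rewrite pM.
Qed.

Lemma conv_one_post (A B : pzAlgType k) (p : A -> B) :
  alg_morphism p -> p \o conv_one A = conv_one B.
Proof.
by move=> [lp p1 _]; apply/funext => x /=; rewrite linear_mapZ // p1.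
Qed.

Local Notation S := (@antipode k H).

(** Push the two antipode axioms forward along [p]; composing with an algebra
    morphism on the left preserves convolution products. *)
Lemma conv_antipode (A : pzAlgType k) (p : H -> A) : alg_morphism p ->
  conv (p \o S) p = conv_one A /\ conv p (p \o S) = conv_one A.
Proof.
move=> pm; have lS := @antipode_linear k H; have lid := @linear_idfun k H.
have Sl : conv S idfun = conv_one H by apply/funext => x; apply: antipodel.
have Sr : conv idfun S = conv_one H by apply/funext => x; apply: antipoder.
by split; rewrite -(conv_one_post pm); [rewrite -Sl | rewrite -Sr];
  rewrite conv_post.
Qed.

End Convolution.

(** * The antipode *)

Section Antipode.
Variables (k : fieldType) (H : hopfAlgType k).
Local Notation S := (@antipode k H).
Let lS : linear S := @antipode_linear k H.
Let lid : linear (idfun : H -> H) := @linear_idfun k H.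

Lemma conv_cancel (f : H -> H) :
  linear f -> f = conv (conv f idfun) S.
Proof.
move=> lf; have [_ idS] := conv_antipode (alg_morphism_id H).
by rewrite convA // [conv idfun S]idS convf1.
Qed.

Lemma antipode1 : S 1 = 1.
Proof.
have D1 : comul (1 : H) = (1 : H) ⊗ (1 : H) by case: (comul_alg H).
have [_ e1 _] := counit_alg H.
have := antipodel (1 : H); rewrite D1 e1 scale1r tensor_map_pure //.
by rewrite tensor_multiply_pure mulr1.
Qed.

(** The antipode axiom at a product is [S (x1 y1) x2 y2 = counit x counit y],
    with the indices of the coproducts as subscripts. For fixed [x] this is a
    convolution in [y] with the identity, and [conv_cancel] removes [y2]:
    [S (x1 y) x2 = counit x S y]. For fixed [y] the same cancellation in [x]
    gives [S (x y) = S y S x]. Working in one variable at a time avoids a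
    coalgebra structure on [H ⊗ H]. *)
Lemma antipodeM (x y : H) : S (x * y) = S y * S x.
Proof.
have [lD _ DM] := comul_alg H; have [le _ eM] := counit_alg H.
have lsS (a b : H) : linear (fun z : H => S (a * z) * b).
  exact: (linear_comp (pz_mulr_linear b) (linear_comp lS (pz_mull_linear a))).
have lSy (y' : H) : linear (fun z : H => S (z * y')).
  exact: (linear_comp lS (pz_mulr_linear y')).
have step x' : (fun y' => conv (fun z => S (z * y')) idfun x') =
    (fun y' => (counit x' : k) *: S y').
  have [s xs] := tensor_sum_pure (comul x').
  pose F y' := \sum_(p <- s) S (p.1 * y') * p.2.
  have lF : linear F by apply: linear_bigsum => p; apply: lsS.
  transitivity F.
    by apply/funext => y'; rewrite (conv_sum (lSy y') lid xs).
  (* the antipode axiom at [x' * y'], summed over both coproducts *)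
  have FE : conv F idfun = (fun y' => (counit x' : k) *: conv_one H y').
    apply/funext => y'; have [t yt] := tensor_sum_pure (comul y').
    rewrite (conv_sum lF lid yt) /conv_one scalerA.
    have <- : counit (x' * y') = (counit x' : k) * (counit y' : k) by exact: eM.
    rewrite -antipodel DM xs yt mulr_suml.
    rewrite (linear_map_sum (tensor_map_linear lS lid)).
    rewrite (linear_map_sum (@tensor_multiply_linear k H)).
    under [RHS]eq_bigr => p _.
      rewrite mulr_sumr (linear_map_sum (tensor_map_linear lS lid)).
      rewrite (linear_map_sum (@tensor_multiply_linear k H)).
      under eq_bigr => q _ do rewrite [_ * _]tensor_mul_pure tensor_map_pure //
        tensor_multiply_pure mulrA.
      over.
    rewrite exchange_big /=; apply: eq_bigr => q _.
    by rewrite mulr_suml.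
  rewrite (conv_cancel lF) FE; apply/funext => y'.
  have lc : linear (fun z : H => (counit x' : k) *: conv_one H z).
    move=> a b c; rewrite /= (@conv_one_linear k H H a b c) scalerDr !scalerA.
    by rewrite [in RHS](mulrC a).
  have [t yt] := tensor_sum_pure (comul y').
  rewrite (conv_sum lc lS yt) -[in RHS](conv1f lS).
  rewrite (conv_sum (@conv_one_linear k H H) lS yt) scaler_sumr.
  by apply: eq_bigr => p _; rewrite -pzscalerAl.
transitivity (conv (fun z => (counit z : k) *: S y) S x).
  rewrite -[LHS]/((fun z => S (z * y)) x) (conv_cancel (lSy y)).
  congr (conv _ _ _); apply/funext => z.
  by have /(congr1 (@^~ y)) := step z.
have [s xs] := tensor_sum_pure (comul x).
have lc : linear (fun z : H => (counit z : k) *: S y).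
  exact: (linear_comp (@linear_scaler k _ (S y)) le).
have -> : S x = conv (conv_one H) S x by rewrite conv1f.
rewrite (conv_sum lc lS xs) (conv_sum (@conv_one_linear k H H) lS xs) mulr_sumr.
by apply: eq_bigr => p _; rewrite /conv_one -!pzscalerAl -pzscalerAr mul1r.
Qed.

(** [counit] is the neutral element for convolution in [Hom(H, k)]; its
    convolution inverse is [counit \o S], and a neutral element is its own
    inverse. *)
Lemma counit_antipode (x : H) : counit (S x) = counit x.
Proof.
have eA := counit_alg H; have [le _ _] := eA; have [Se _] := conv_antipode eA.
have oneE : conv_one (k^o : pzAlgType k) = @counit k H.
  by apply/funext => z; apply: mulr1.
have leS := linear_comp le lS.
move: Se; rewrite -oneE convf1 ?oneE // => Se.
exact: (congr1 (@^~ x) Se).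
Qed.

(** The composite of [S ⊗ S] with the exchange of the two factors. *)
Definition flip_antipode : (H ⊗ H)%type -> (H ⊗ H)%type :=
  tensor_lift (fun a b => S b ⊗ S a).

Lemma flip_antipode_bilinear : bilinear_map (fun a b : H => S b ⊗ S a).
Proof.
split=> [b|a].
  exact: (linear_comp (@pure_linearr k H H (S b)) lS).
exact: (linear_comp (@pure_linearl k H H (S a)) lS).
Qed.

Lemma flip_antipode_linear : linear flip_antipode.
Proof. exact/tensor_lift_linear/flip_antipode_bilinear. Qed.

Lemma flip_antipode_pure a b : flip_antipode (a ⊗ b) = S b ⊗ S a.
Proof. exact/tensor_lift_pure/flip_antipode_bilinear. Qed.

(** The coproduct is the convolution product of the two inclusions of [H] in
    [H ⊗ H], hence its convolution inverse [comul \o S] is the product of the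
    inverses of these inclusions in the opposite order. *)
Lemma comul_antipode (x : H) : comul (S x) = flip_antipode (comul x).
Proof.
pose i1 (a : H) : (H ⊗ H)%type := a ⊗ (1 : H).
pose i2 (a : H) : (H ⊗ H)%type := (1 : H) ⊗ a.
have mi1 : alg_morphism i1.
  split=> // [|a b]; first exact: pure_linearl.
  by rewrite [RHS]tensor_mul_pure mulr1.
have mi2 : alg_morphism i2.
  split=> // [|a b]; first exact: pure_linearr.
  by rewrite [RHS]tensor_mul_pure mulr1.
have mD := comul_alg H.
have [[l1 _ _] [l2 _ _] [lD _ _]] := And3 mi1 mi2 mD.
have l1S := linear_comp l1 lS; have l2S := linear_comp l2 lS.
have lDS := linear_comp lD lS.
have DE : @comul k H = conv i1 i2.
  apply/funext => z; have [s zs] := tensor_sum_pure (comul z).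
  rewrite (conv_sum l1 l2 zs) zs; apply: eq_bigr => p _.
  by rewrite [RHS]tensor_mul_pure mulr1 mul1r.
have [S1 i1S] := conv_antipode mi1; have [S2 i2S] := conv_antipode mi2.
have [SD _] := conv_antipode mD.
have l21 := conv_linear l2S l1S.
have inv : conv (@comul k H) (conv (i2 \o S) (i1 \o S)) = conv_one _.
  rewrite DE convA // -(convA l2) // [conv i2 _]i2S conv1f //.
have := conv_inverse_uniq lDS lD l21 SD inv.
move=> /(congr1 (@^~ x)) /= ->.
have [s xs] := tensor_sum_pure (comul x).
rewrite (conv_sum l2S l1S xs) xs (linear_map_sum flip_antipode_linear).
apply: eq_bigr => p _; rewrite flip_antipode_pure /= [LHS]tensor_mul_pure.
by rewrite mulr1 mul1r.
Qed.

Lemma antipode2_alg : alg_morphism (S \o S).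
Proof.
split=> [|/=|a b /=]; first exact: linear_comp.
  by rewrite !antipode1.
by rewrite !antipodeM.
Qed.

Lemma comul_antipode2 (x : H) :
  comul (S (S x)) = ((S \o S) ⊗ (S \o S))%tens (comul x).
Proof.
rewrite !comul_antipode; move: (comul x) => y {x}; move: y.
have lSS := linear_comp lS lS.
apply: linear_tensor_ext.
- exact: (linear_comp flip_antipode_linear flip_antipode_linear).
- exact: tensor_map_linear.
by move=> a b; rewrite tensor_map_pure // !flip_antipode_pure.
Qed.

End Antipode.

(** * Quotient algebras *)

Definition two_sided_ideal (k : fieldType) (A : pzAlgType k) (J : set A) :=
  [/\ J 0,
      forall (a : k) x y, J x -> J y -> J (a *: x + y),
      forall a x, J x -> J (a * x)
    & forall a x, J x -> J (x * a)].

Lemma kernel_ideal (k : fieldType) (A B : pzAlgType k) (f : A -> B) :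
  alg_morphism f -> two_sided_ideal [set x | f x = 0]%classic.
Proof.
move=> [lf _ fM]; split=> [|a x y /= fx fy|a x /= fx|a x /= fx].
- exact: linear_map0.
- by rewrite lf fx fy scaler0 addr0.
- by rewrite fM fx mulr0.
- by rewrite fM fx mul0r.
Qed.

Section Quotient.
Variables (k : fieldType) (A : pzAlgType k) (J : set A).
Hypothesis idJ : two_sided_ideal J.

Let J0 : J 0. Proof. by case: idJ. Qed.
Let JZD a x y : J x -> J y -> J (a *: x + y).
Proof. by case: idJ => _ J1 _ _; apply: J1. Qed.
Let JMl a x : J x -> J (a * x). Proof. by case: idJ => _ _ J1 _; apply: J1. Qed.
Let JMr a x : J x -> J (x * a). Proof. by case: idJ => _ _ _; apply. Qed.
Let JZ a x : J x -> J (a *: x).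
Proof. by move=> Jx; rewrite -[_ *: _]addr0; apply: JZD. Qed.
Let JD x y : J x -> J y -> J (x + y).
Proof. by move=> Jx; rewrite -[x]scale1r; apply: JZD. Qed.

Definition congruent (x y : A) : bool := `[< J (x - y) >].

Lemma congruent_refl : reflexive congruent.
Proof. by move=> x; apply/asboolP; rewrite subrr. Qed.

Lemma congruent_sym : symmetric congruent.
Proof.
suff imp x y : congruent x y -> congruent y x.
  by move=> x y; apply/idP/idP; apply: imp.
by move=> /asboolP Jxy; apply/asboolP; rewrite -opprB -scaleN1r; apply: JZ.
Qed.

Lemma congruent_trans : transitive congruent.
Proof.
move=> y x z /asboolP Jxy /asboolP Jyz; apply/asboolP.
by rewrite -(subrKA y); apply: JD.
Qed.

Canonical congruent_equiv :=
  EquivRel congruent congruent_refl congruent_sym congruent_trans.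

Definition quotient : Type := {eq_quot congruent}%qT.
HB.instance Definition _ := Choice.on quotient.
HB.instance Definition _ := EqQuotient.on quotient.

Definition proj (x : A) : quotient := (\pi x)%qT.

Lemma proj_eq x y : proj x = proj y <-> J (x - y).
Proof. by split=> [/eqquotP/asboolP|Jxy] //; apply/eqquotP/asboolP. Qed.

Lemma proj_repr (x : quotient) : proj (repr x) = x.
Proof. exact: reprK. Qed.

Lemma proj_surj (x : quotient) : exists y, x = proj y.
Proof. by exists (repr x); rewrite proj_repr. Qed.

Lemma repr_proj x : J (repr (proj x) - x).
Proof. by apply/proj_eq; rewrite proj_repr. Qed.

Definition quot_add (x y : quotient) := proj (repr x + repr y).
Definition quot_scale (a : k) (x : quotient) := proj (a *: repr x).
Definition quot_opp (x : quotient) := quot_scale (-1) x.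
Definition quot_mul (x y : quotient) := proj (repr x * repr y).

Let addE x y : quot_add (proj x) (proj y) = proj (x + y).
Proof. by apply/proj_eq; rewrite opprD addrACA; apply: JD; apply: repr_proj. Qed.

Let scaleE a x : quot_scale a (proj x) = proj (a *: x).
Proof. by apply/proj_eq; rewrite -scalerBr; apply/JZ/repr_proj. Qed.

Let mulE x y : quot_mul (proj x) (proj y) = proj (x * y).
Proof.
apply/proj_eq; set x' := repr _; set y' := repr _.
have -> : x' * y' - x * y = x' * (y' - y) + (x' - x) * y.
  by rewrite mulrBr mulrBl subrKA.
by apply: JD; [apply: JMl | apply: JMr]; apply: repr_proj.
Qed.

Let addA : associative quot_add.
Proof.
move=> x y z.
have [[a ->] [b ->]] := (proj_surj x, proj_surj y); have [c ->] := proj_surj z.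
by rewrite !addE addrA.
Qed.

Let addC : commutative quot_add.
Proof.
move=> x y; have [[a ->] [b ->]] := (proj_surj x, proj_surj y).
by rewrite !addE addrC.
Qed.

Let add0 : left_id (proj 0) quot_add.
Proof. by move=> x; have [a ->] := proj_surj x; rewrite addE add0r. Qed.

Let addN : left_inverse (proj 0) quot_opp quot_add.
Proof.
move=> x; have [a ->] := proj_surj x.
by rewrite /quot_opp scaleE addE scaleN1r addNr.
Qed.

HB.instance Definition _ := GRing.isZmodule.Build quotient addA addC add0 addN.

Let scaleA a b x : quot_scale a (quot_scale b x) = quot_scale (a * b) x.
Proof. by have [y ->] := proj_surj x; rewrite !scaleE scalerA. Qed.

Let scale1 : left_id 1 quot_scale.
Proof. by move=> x; have [y ->] := proj_surj x; rewrite scaleE scale1r. Qed.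

Let scaleDr : right_distributive quot_scale +%R.
Proof.
move=> a x y; have [[b ->] [c ->]] := (proj_surj x, proj_surj y).
by rewrite [_ + _]addE !scaleE scalerDr [RHS]addE.
Qed.

Let scaleDl x : {morph quot_scale^~ x : a b / a + b}.
Proof.
by move=> a b; have [y ->] := proj_surj x; rewrite !scaleE scalerDl [RHS]addE.
Qed.

HB.instance Definition _ :=
  GRing.Zmodule_isLmodule.Build k quotient scaleA scale1 scaleDr scaleDl.

Let mulA : associative quot_mul.
Proof.
move=> x y z.
have [[a ->] [b ->]] := (proj_surj x, proj_surj y); have [c ->] := proj_surj z.
by rewrite !mulE mulrA.
Qed.

Let mul1 : left_id (proj 1) quot_mul.
Proof. by move=> x; have [a ->] := proj_surj x; rewrite mulE mul1r. Qed.

Let mulq1 : right_id (proj 1) quot_mul.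
Proof. by move=> x; have [a ->] := proj_surj x; rewrite mulE mulr1. Qed.

Let mulDl : left_distributive quot_mul +%R.
Proof.
move=> x y z.
have [[a ->] [b ->]] := (proj_surj x, proj_surj y); have [c ->] := proj_surj z.
by rewrite [_ + _]addE !mulE mulrDl [RHS]addE.
Qed.

Let mulDr : right_distributive quot_mul +%R.
Proof.
move=> x y z.
have [[a ->] [b ->]] := (proj_surj x, proj_surj y); have [c ->] := proj_surj z.
by rewrite [_ + _]addE !mulE mulrDr [RHS]addE.
Qed.

Let scaleAl (a : k) (x y : quotient) : a *: quot_mul x y = quot_mul (a *: x) y.
Proof.
have [[b ->] [c ->]] := (proj_surj x, proj_surj y).
by rewrite mulE [LHS]scaleE [X in quot_mul X _]scaleE mulE pzscalerAl.
Qed.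

Let scaleAr (a : k) (x y : quotient) : a *: quot_mul x y = quot_mul x (a *: y).
Proof.
have [[b ->] [c ->]] := (proj_surj x, proj_surj y).
by rewrite mulE [LHS]scaleE [X in quot_mul _ X]scaleE mulE pzscalerAr.
Qed.

HB.instance Definition _ := Lmodule_isPzAlgebra.Build k quotient
  mulA mul1 mulq1 mulDl mulDr scaleAl scaleAr.
HB.instance Definition _ := GRing.PzRing.copy quotient (PzAlgebra.sort quotient).

Lemma proj_alg : alg_morphism proj.
Proof.
split=> [a x y||x y]; last exact/esym/mulE; last by [].
by rewrite -addE -scaleE.
Qed.

(** The map on the quotient induced by [f]; it is meaningful when [f] is
    linear and kills [J]. *)
Definition quot_lift (X : Type) (f : A -> X) (x : quotient) : X := f (repr x).

Section Lift.
Variables (X : lmodType k) (f : A -> X).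
Hypotheses (lf : linear f) (fJ : forall z, J z -> f z = 0).

Lemma quot_lift_proj x : quot_lift f (proj x) = f x.
Proof.
by apply/subr0_eq; rewrite /quot_lift -linear_mapB // fJ //; apply: repr_proj.
Qed.

Lemma quot_lift_linear : linear (quot_lift f).
Proof.
move=> a x y; have [[b ->] [c ->]] := (proj_surj x, proj_surj y).
by have [lp _ _] := proj_alg; rewrite -lp !quot_lift_proj lf.
Qed.

End Lift.

Lemma quot_lift_alg (B : pzAlgType k) (f : A -> B) :
  alg_morphism f -> (forall z, J z -> f z = 0) -> alg_morphism (quot_lift f).
Proof.
move=> [lf f1 fM] fJ; have [_ p1 pM] := proj_alg.
split; [exact: quot_lift_linear | by rewrite -p1 quot_lift_proj | move=> x y].
have [[b ->] [c ->]] := (proj_surj x, proj_surj y).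
by rewrite -pM !quot_lift_proj.
Qed.

End Quotient.

(** * Quotient Hopf algebras *)

Section QuotientHopf.
Variables (k : fieldType) (H : hopfAlgType k) (J : set H).
Hypothesis idJ : two_sided_ideal J.
Local Notation Q := (quotient idJ).
Local Notation q := (proj idJ).

(** The kernel of [q ⊗ q] is [J ⊗ H + H ⊗ J], so this is the coproduct condition
    of a Hopf ideal, in the form in which it is used. *)
Hypothesis comulJ : forall z, J z -> (q ⊗ q)%tens (comul z) = 0.
Hypothesis counitJ : forall z, J z -> counit z = 0.
Hypothesis antipodeJ : forall z, J z -> J (antipode z).

Let lq : linear q. Proof. by case: (proj_alg idJ). Qed.
Let lD : linear (@comul k H) := comul_linear (H := H).
Let le : linear (@counit k H) := counit_linear (H := H).
Let lS : linear (@antipode k H) := @antipode_linear k H.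
Let lqq : linear (q ⊗ q)%tens := tensor_map_linear lq lq.
Let lid (U : lmodType k) : linear (idfun : U -> U) := @linear_idfun k U.

Let D := quot_lift ((q ⊗ q)%tens \o @comul k H) : Q -> (Q ⊗ Q)%type.
Let e := quot_lift (@counit k H) : Q -> k^o.
Let S := quot_lift (q \o @antipode k H) : Q -> Q.

Let qS0 z : J z -> (q \o @antipode k H) z = 0.
Proof.
move=> Jz; rewrite -(linear_map0 lq); apply/proj_eq.
by rewrite subr0; apply: antipodeJ.
Qed.

Let Dq x : D (q x) = (q ⊗ q)%tens (comul x).
Proof. exact: (quot_lift_proj idJ (linear_comp lqq lD) comulJ). Qed.

Let eQ x : e (q x) = counit x.
Proof. exact: (quot_lift_proj idJ le counitJ). Qed.

Let Sq x : S (q x) = q (antipode x).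
Proof. exact: (quot_lift_proj idJ (linear_comp lq lS) qS0). Qed.

Let DA : alg_morphism D.
Proof.
apply: (quot_lift_alg idJ _ comulJ); apply: alg_morphism_comp (comul_alg H).
exact: tensor_map_mul (proj_alg _) (proj_alg _).
Qed.

Let eA : alg_morphism e.
Proof. exact: (quot_lift_alg idJ (counit_alg H) counitJ). Qed.

Let lS' : linear S.
Proof. exact: (quot_lift_linear (linear_comp lq lS) qS0). Qed.

Let lD' : linear D. Proof. by case: DA. Qed.
Let le' : linear e. Proof. by case: eA. Qed.

Let coassoc x : tensor_assoc ((D ⊗ idfun)%tens (D x)) = (idfun ⊗ D)%tens (D x).
Proof.
have [y ->] := proj_surj x; rewrite Dq !tensor_map_comp //.
have -> : D \o q = (q ⊗ q)%tens \o @comul k H by apply/funext => z; apply: Dq.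
rewrite -(tensor_map_comp (f' := (q ⊗ q)%tens) (g' := q) (g := idfun)) //.
rewrite -(tensor_map_comp (f' := q) (g' := (q ⊗ q)%tens) (f := idfun)) //.
by rewrite tensor_assoc_map // comulA.
Qed.

Let unitl x : tensor_unitl ((e ⊗ idfun)%tens (D x)) = x.
Proof.
have [y ->] := proj_surj x; rewrite Dq tensor_map_comp //.
have -> : e \o q = @counit k H by apply/funext => z; apply: eQ.
rewrite -[in RHS](counitl y); have [s ->] := tensor_sum_pure (comul y).
rewrite !(linear_map_sum (tensor_map_linear _ _)) //.
rewrite !(linear_map_sum (@tensor_unitl_linear k _)) (linear_map_sum lq).
apply: eq_bigr => p _; rewrite !tensor_map_pure // !tensor_unitl_pure.
by rewrite linear_mapZ.
Qed.

Let unitr x : tensor_unitr ((idfun ⊗ e)%tens (D x)) = x.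
Proof.
have [y ->] := proj_surj x; rewrite Dq tensor_map_comp //.
have -> : e \o q = @counit k H by apply/funext => z; apply: eQ.
rewrite -[in RHS](counitr y); have [s ->] := tensor_sum_pure (comul y).
rewrite !(linear_map_sum (tensor_map_linear _ _)) //.
rewrite !(linear_map_sum (@tensor_unitr_linear k _)) (linear_map_sum lq).
apply: eq_bigr => p _; rewrite !tensor_map_pure // !tensor_unitr_pure.
by rewrite linear_mapZ.
Qed.

Let antil x : tensor_multiply ((S ⊗ idfun)%tens (D x)) = (e x : k) *: (1 : Q).
Proof.
have [y ->] := proj_surj x; rewrite Dq eQ tensor_map_comp //.
have -> : S \o q = q \o @antipode k H by apply/funext => z; apply: Sq.
have [+ _] := conv_antipode (proj_alg idJ).
exact: (congr1 (@^~ y)).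
Qed.

Let antir x : tensor_multiply ((idfun ⊗ S)%tens (D x)) = (e x : k) *: (1 : Q).
Proof.
have [y ->] := proj_surj x; rewrite Dq eQ tensor_map_comp //.
have -> : S \o q = q \o @antipode k H by apply/funext => z; apply: Sq.
have [_ +] := conv_antipode (proj_alg idJ).
exact: (congr1 (@^~ y)).
Qed.

Definition quotient_hopf : hopfAlgType k :=
  HopfAlgType DA eA lS' coassoc unitl unitr antil antir.

Lemma proj_hopf : @hopf_morphism k H quotient_hopf q.
Proof.
split; [exact: proj_alg | exact: Dq | exact: eQ | exact: Sq].
Qed.

End QuotientHopf.

(** * Corepresentations and transposition *)

Section Corepresentation.
Variables (k : fieldType) (V : vectType k) (H : hopfAlgType k).
Local Notation S := (@antipode k H).
Let lid (U : lmodType k) : linear (idfun : U -> U) := @linear_idfun k U.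
Let lS : linear S := @antipode_linear k H.

(** Multiplying the second and third legs collapses [a_12 b_13], with [f] and [g]
    applied on the way, to a product in [L(V) ⊗ A]. *)
Lemma legs_multiply (A : pzAlgType k) (f g : H -> A) (a b : (endo V ⊗ H)%type) :
  linear f -> linear g ->
  (idfun ⊗ (@tensor_multiply k A \o (f ⊗ g)%tens))%tens (leg12 a * leg13 b) =
  (idfun ⊗ f)%tens a * (idfun ⊗ g)%tens b.
Proof.
move=> lf lg.
have lidV : linear (idfun : endo V -> endo V) by [].
have li1 : linear (fun h : H => h ⊗ (1 : H)) by exact: pure_linearl.
have li2 : linear (fun h : H => (1 : H) ⊗ h) by exact: pure_linearr.
have lm (C : pzAlgType k) (c : C) := pz_mull_linear c.
have rm (C : pzAlgType k) (c : C) := pz_mulr_linear c.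
have lfg := linear_comp (@tensor_multiply_linear k A) (tensor_map_linear lf lg).
have lL := tensor_map_linear lidV lfg.
have lF := tensor_map_linear lidV lf.
have lG := tensor_map_linear lidV lg.
have l12 := tensor_map_linear lidV li1.
have l13 := tensor_map_linear lidV li2.
move: a; apply: linear_tensor_ext.
- exact: (linear_comp lL (linear_comp (rm _ (leg13 b)) l12)).
- exact: (linear_comp (rm _ _) lF).
move=> T x; move: b; apply: linear_tensor_ext.
- exact: (linear_comp lL (linear_comp (lm _ (leg12 (T ⊗ x))) l13)).
- exact: (linear_comp (lm _ _) lG).
move=> T' x'; rewrite /leg12 /leg13 !tensor_map_pure //.
rewrite [X in (idfun ⊗ _)%tens X]tensor_mul_pure [X in _ ⊗ X]tensor_mul_pure.
rewrite [RHS]tensor_mul_pure tensor_map_pure //= tensor_map_pure // mulr1 mul1r.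
by rewrite tensor_multiply_pure.
Qed.

Variable v : (endo V ⊗ H)%type.
Hypothesis vP : corepresentation v.

(** Since [(id ⊗ comul) v = v_12 v_13], the assignment
    [f |-> (id ⊗ f) v] carries convolution to multiplication; with
    [corep_conv_one] it is a unital morphism, so it carries inverses to
    inverses. *)
Lemma corep_conv (A : pzAlgType k) (f g : H -> A) : linear f -> linear g ->
  (idfun ⊗ f)%tens v * (idfun ⊗ g)%tens v = (idfun ⊗ conv f g)%tens v.
Proof.
move=> lf lg; have [Dv _] := vP; have lD := comul_linear (H := H).
have lfg := linear_comp (@tensor_multiply_linear k A) (tensor_map_linear lf lg).
by rewrite -legs_multiply // -Dv tensor_map_comp.
Qed.

Lemma corep_conv_one (A : pzAlgType k) : (idfun ⊗ conv_one A)%tens v = 1.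
Proof.
have [_ ev] := vP; have le := counit_linear (H := H).
have l1 := linear_scaler (1 : A).
rewrite -[RHS]/((1 : endo V) ⊗ (1 : A)) -ev.
rewrite -(tensor_map_comp (f' := idfun) (g' := fun a : k^o => (a : k) *: (1 : A))
  (f := idfun)) //.
move: ((idfun ⊗ _)%tens v); apply: linear_tensor_ext.
- exact: tensor_map_linear.
- exact: (linear_comp (@pure_linearl k _ _ (1 : A)) (@tensor_unitr_linear k _)).
move=> T a; rewrite tensor_map_pure // tensor_unitr_pure.
by rewrite linear_mapZ ?(linear_mapZ (@pure_linearl k _ _ _)) //;
  exact: pure_linearr.
Qed.

Lemma corep_inverse (A : pzAlgType k) (p : H -> A) : alg_morphism p ->
  is_inverse ((idfun ⊗ p)%tens v) ((idfun ⊗ (p \o S))%tens v).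
Proof.
move=> pA; have [lp _ _] := pA; have lpS := linear_comp lp lS.
have [Sp pS] := conv_antipode pA.
by split; rewrite corep_conv // ?Sp ?pS corep_conv_one.
Qed.

End Corepresentation.

Section Transpose.
Variables (k : fieldType) (V : vectType k).
Local Notation t := (@transpose k V).

Lemma transposeM (a b : endo V) : t (a * b) = t b * t a.
Proof.
apply/lfunP => f; rewrite [RHS]comp_lfunE !transposeE.
exact: comp_lfunA.
Qed.

Lemma transpose1 : t 1 = 1.
Proof.
apply/lfunP => f; rewrite transposeE [RHS]id_lfunE.
exact: comp_lfun1r.
Qed.

(** Coordinate forms detect equality of vectors. *)
Lemma transpose_inj : injective t.
Proof.
move=> a b tab; apply/lfunP => x.
rewrite (coord_vbasis (memvf (a x))) (coord_vbasis (memvf (b x))).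
apply: eq_bigr => i _; congr (_ *: _).
pose c : V -> k^o := coord (vbasis {:V}) i.
have lc : linear c by move=> z y w; rewrite /c linearP.
pose c' : {linear V -> k^o} := HB.pack c (GRing.isLinear.Build k V k^o _ c lc).
pose ev (T : endo (dual V)) := (T : 'End(dual V)) (linfun c' : dual V) x.
have := congr1 ev tab; rewrite /ev.
by rewrite !transposeE !comp_lfunE !lfunE.
Qed.

(** An injective map of vector spaces has a linear retraction, so it stays
    injective after tensoring. *)
Lemma transpose_tensor_inj (W : lmodType k) :
  injective (@transpose k V ⊗ (idfun : W -> W))%tens.
Proof.
have lt := @transpose_linear k V.
pose t' : {linear endo V -> endo (dual V)} :=
  HB.pack t (GRing.isLinear.Build k _ _ _ t lt).
pose r : endo (dual V) -> endo V := ((linfun t')^-1)%VF.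
have lr : linear r by move=> a x y; rewrite /r linearP.
have rt : r \o t = idfun.
  apply/funext => a /=; rewrite -[t a](lfunE t') /r lker0_lfunK //.
  apply/lker0P => x y; rewrite !lfunE; exact: transpose_inj.
apply: (can_inj (g := (r ⊗ idfun)%tens)) => x.
by rewrite tensor_map_comp // rt tensor_map_id.
Qed.

Variables (H : hopfAlgType k) (v : (endo V ⊗ H)%type).
Hypothesis vP : corepresentation v.
Local Notation S := (@antipode k H).

(** [t ⊗ S] reverses products, so it turns the inverse [(id ⊗ S) v] of [v]
    into the inverse of [(t ⊗ S) v]. *)
Lemma transpose_corep_inverse (A : pzAlgType k) (p : H -> A) : alg_morphism p ->
  is_inverse ((t ⊗ (p \o S))%tens v) ((t ⊗ (p \o S \o S))%tens v).
Proof.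
move=> pA; have [lp p1 pM] := pA.
have lS := @antipode_linear k H; have lt := @transpose_linear k V.
have lid := @linear_idfun k (endo V); have lpS := linear_comp lp lS.
have pSM x y : (p \o S) (x * y) = (p \o S) y * (p \o S) x.
  by rewrite /= antipodeM pM.
have tM := tensor_map_antimul lt lpS transposeM pSM.
have t1 : (t ⊗ (p \o S))%tens 1 = 1.
  by rewrite [LHS]tensor_map_pure // transpose1 /= antipode1 p1.
have := corep_inverse vP (alg_morphism_id H); rewrite tensor_map_id => -[vw wv].
have -> : (t ⊗ (p \o S \o S))%tens v =
    (t ⊗ (p \o S))%tens ((idfun ⊗ (idfun \o S))%tens v).
  by rewrite tensor_map_comp.
by split; rewrite -tM ?vw ?wv.
Qed.

End Transpose.

(** * Coefficients and the Hopf algebras they generate *)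

Section GeneratedHopf.
Variables (k : fieldType) (V : vectType k).

Lemma equalizer_subalgebra (A : pzAlgType k) (H : hopfAlgType k) (f g : H -> A) :
  alg_morphism f -> alg_morphism g -> subalgebra [set x : H | f x = g x]%classic.
Proof.
move=> [lf f1 fM] [lg g1 gM]; split=> [|a x y /= fx fy|x y /= fx fy].
- by rewrite /= f1 g1.
- by rewrite lf lg fx fy.
- by rewrite fM gM fx fy.
Qed.

Lemma generated_hopf_subalgebra (H : hopfAlgType k) (C : set H) :
  subalgebra (generated_hopf C).
Proof.
split=> [|a x y Cx Cy|x y Cx Cy] P [PA CP].
- by case: PA.
- by have [_ + _] := PA; apply; [apply: Cx | apply: Cy].
- by have [_ _] := PA; apply; [apply: Cx | apply: Cy].
Qed.

Lemma generated_hopf_ind (H : hopfAlgType k) (C P : set H) :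
  generated_hopf C = [set: H]%classic -> subalgebra P ->
  (forall n c, C c -> P (iter n (@antipode k H) c)) -> forall x, P x.
Proof.
move=> genC PA CP x; have : generated_hopf C x by rewrite genC.
by apply; split=> // _ [n _ [c Cc <-]]; apply: CP.
Qed.

Lemma generated_hopf_mem (H : hopfAlgType k) (C : set H) n c :
  C c -> generated_hopf C (iter n (@antipode k H) c).
Proof. by move=> Cc P [_]; apply; exists n => //; exists c. Qed.

Variables (H1 H2 : hopfAlgType k) (f : H1 -> H2).
Hypothesis fP : hopf_morphism f.

Lemma hopf_morphism_iter n x :
  f (iter n (@antipode k H1) x) = iter n (@antipode k H2) (f x).
Proof. by have [_ _ _ fS] := fP; elim: n => //= n IHn; rewrite -fS IHn. Qed.

Lemma coefficient_map (v : (endo V ⊗ H1)%type) (phi : endo V -> k^o) :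
  linear phi ->
  tensor_unitl ((phi ⊗ idfun)%tens ((idfun ⊗ f)%tens v)) =
  f (tensor_unitl ((phi ⊗ idfun)%tens v)).
Proof.
have [[lf _ _] _ _ _] := fP; move=> lphi; have lid U := @linear_idfun k U.
rewrite tensor_map_comp //; have [s ->] := tensor_sum_pure v.
rewrite !(linear_map_sum (tensor_map_linear _ _)) //.
rewrite !(linear_map_sum (@tensor_unitl_linear k _)) (linear_map_sum lf).
apply: eq_bigr => p _; rewrite !tensor_map_pure // !tensor_unitl_pure.
by rewrite linear_mapZ.
Qed.

Lemma corepresentation_map (v : (endo V ⊗ H1)%type) :
  corepresentation v -> corepresentation ((idfun ⊗ f)%tens v).
Proof.
have [fA fD fe _] := fP; move=> [Dv ev]; have [lf f1 _] := fA.
have lid := @linear_idfun k (endo V).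
have lff := tensor_map_linear lf lf.
have lD1 := comul_linear (H := H1); have lD2 := comul_linear (H := H2).
have lr (H : hopfAlgType k) : linear (fun h : H => h ⊗ (1 : H)).
  exact: pure_linearl.
have ll (H : hopfAlgType k) : linear (fun h : H => (1 : H) ⊗ h).
  exact: pure_linearr.
have le := counit_linear (H := H2).
split; last first.
  rewrite tensor_map_comp //.
  have -> : @counit k H2 \o f = @counit k H1 by apply/funext => z; apply: fe.
  exact: ev.
rewrite tensor_map_comp //.
have -> : @comul k H2 \o f = (f ⊗ f)%tens \o @comul k H1.
  by apply/funext => z; apply: fD.
rewrite -(tensor_map_comp (f' := idfun) (g' := (f ⊗ f)%tens) (f := idfun)) //.
rewrite Dv.
have [_ _ ->] := tensor_map_mul (alg_morphism_id (endo V)) (tensor_map_mul fA fA).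
rewrite /leg12 /leg13 !tensor_map_comp //; do ?[exact: lr | exact: ll].
by congr ((idfun ⊗ _)%tens v * (idfun ⊗ _)%tens v);
  apply/funext => h /=; rewrite tensor_map_pure // f1.
Qed.

Lemma generated_hopf_map (v : (endo V ⊗ H1)%type) :
  (forall y, exists x, y = f x) ->
  generated_hopf (coefficients v) = [set: H1]%classic ->
  generated_hopf (coefficients ((idfun ⊗ f)%tens v)) = [set: H2]%classic.
Proof.
move=> fsurj gen; apply/seteqP; split=> // y _; have [x ->] := fsurj y.
have [[lf f1 fM] _ _ _] := fP.
have [G1 GZD GM] := generated_hopf_subalgebra (coefficients ((idfun ⊗ f)%tens v)).
pose P := [set x | generated_hopf (coefficients ((idfun ⊗ f)%tens v)) (f x)]%classic.
apply: (generated_hopf_ind (P := P) gen).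
  split=> [|a x1 x2 Px Py|x1 x2 Px Py]; rewrite /P /=.
  - by rewrite f1.
  - by rewrite lf; apply: GZD.
  - by rewrite fM; apply: GM.
move=> n _ [phi lphi ->]; rewrite /P /= hopf_morphism_iter.
by apply: generated_hopf_mem; exists phi; rewrite ?coefficient_map.
Qed.

End GeneratedHopf.

(** * The largest quotient with involutive antipode *)

Section InvolutiveQuotient.
Variables (k : fieldType) (H : hopfAlgType k).
Local Notation S := (@antipode k H).

Definition involutive_ideal : set H :=
  smallest (@two_sided_ideal k H) [set S (S x) - x | x in [set: H]]%classic.

Lemma involutive_idealP : two_sided_ideal involutive_ideal.
Proof.
split=> [|a x y Jx Jy|a x Jx|a x Jx] I [II GI]; have [I0 IZD IMl IMr] := II.
- by [].
- by apply: IZD; [apply: Jx | apply: Jy].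
- by apply: IMl; apply: Jx.
- by apply: IMr; apply: Jx.
Qed.

Lemma involutive_ideal_gen x : involutive_ideal (S (S x) - x).
Proof. by move=> I [_]; apply; exists x. Qed.

Lemma involutive_ideal_ind (I : set H) : two_sided_ideal I ->
  (forall x, I (S (S x) - x)) -> forall z, involutive_ideal z -> I z.
Proof. by move=> II GI z; apply; split=> // _ [x _ <-]. Qed.

Lemma involutive_ideal_kernel (A : pzAlgType k) (f : H -> A) :
  alg_morphism f -> (forall x, f (S (S x)) = f x) ->
  forall z, involutive_ideal z -> f z = 0.
Proof.
move=> fA fSS; apply: (involutive_ideal_ind (kernel_ideal fA)) => x /=.
by have [lf _ _] := fA; rewrite linear_mapB // fSS subrr.
Qed.

Local Notation idJ := involutive_idealP.
Local Notation q := (proj idJ).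

Lemma proj_antipode2 x : q (S (S x)) = q x.
Proof. by apply/proj_eq; apply: involutive_ideal_gen. Qed.

(** The algebra morphism [(q ⊗ q) comul] is unchanged by composition with [S S],
    because [S S] commutes with [comul] and [q] absorbs it. *)
Lemma involutive_ideal_comul z : involutive_ideal z -> (q ⊗ q)%tens (comul z) = 0.
Proof.
have qA := proj_alg idJ; have [lq _ _] := qA.
have [lSS _ _] := antipode2_alg H.
apply: (involutive_ideal_kernel
  (f := (q ⊗ q)%tens \o @comul k H)) => [|x /=].
  exact: (alg_morphism_comp (tensor_map_mul qA qA) (comul_alg H)).
rewrite comul_antipode2 tensor_map_comp //.
by have -> : q \o (S \o S) = q by apply/funext => y; apply: proj_antipode2.
Qed.

Lemma involutive_ideal_counit z : involutive_ideal z -> counit z = 0.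
Proof.
apply: (involutive_ideal_kernel (counit_alg H)) => x.
by rewrite !counit_antipode.
Qed.

Lemma involutive_ideal_antipode z : involutive_ideal z -> involutive_ideal (S z).
Proof.
have lS := @antipode_linear k H; have [J0 JZD JMl JMr] := idJ.
apply: (@involutive_ideal_ind [set x | involutive_ideal (S x)]%classic) => [|x /=].
  split=> [|a x y Jx Jy|a x Jx|a x Jx] /=.
  - by rewrite linear_map0.
  - by rewrite lS; apply: JZD.
  - by rewrite antipodeM; apply: JMr.
  - by rewrite antipodeM; apply: JMl.
by rewrite linear_mapB //; apply: involutive_ideal_gen.
Qed.

Definition involutive_quotient : hopfAlgType k :=
  quotient_hopf involutive_ideal_comul involutive_ideal_counit
    involutive_ideal_antipode.

Lemma involutive_proj_hopf : @hopf_morphism k H involutive_quotient q.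
Proof. exact: proj_hopf. Qed.

Lemma involutive_quotientP (x : involutive_quotient) : antipode (antipode x) = x.
Proof.
have [y ->] := proj_surj x; have [_ _ _ qS] := involutive_proj_hopf.
by rewrite !qS proj_antipode2.
Qed.

End InvolutiveQuotient.

(** * Minimal models *)

Section MinimalModel.
Variables (k : fieldType) (V W : vectType k).

(** [(t ⊗ p) v] and [(t ⊗ p S S) v] are both inverse to [(t ⊗ p S) v]: the first
    by the hypothesis on [u], the second by [transpose_corep_inverse]. *)
Lemma transpose_inverse_antipode2 (H : hopfAlgType k) (v : (endo V ⊗ H)%type)
    (p : H -> endo W) : corepresentation v -> alg_morphism p ->
  transpose_inverse ((idfun ⊗ p)%tens v) ->
  (idfun ⊗ (p \o @antipode k H \o @antipode k H))%tens v = (idfun ⊗ p)%tens v.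
Proof.
move=> vP pA [_ tinv]; have [lp _ _] := pA.
have lS := @antipode_linear k H; have lt := @transpose_linear k V.
have lid U := @linear_idfun k U.
rewrite (inverseE (corep_inverse vP pA)) => tuE.
apply: transpose_tensor_inj.
have := is_inverse_sym (is_inverse_inverse tinv); rewrite -tuE => uinv.
apply: is_inverse_uniq uinv.
have := transpose_corep_inverse vP pA.
have lpS := linear_comp lp lS; have lpSS := linear_comp lpS lS.
by rewrite !tensor_map_comp.
Qed.

Variables (u : (endo V ⊗ endo W)%type) (M : model u).
Hypothesis minM : minimal_model M.
Hypothesis tinv : transpose_inverse u.
Local Notation H := (model_hopf M).
Local Notation S := (@antipode k H).
Local Notation p := (@model_rep k V W u M).
Local Notation v := (model_corep M).

Let genH : left_faithful M. Proof. by case: minM. Qed.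

(** The equality [(id ⊗ p S S) v = u] only compares [p S S] and [p] on the
    coefficients of [v], and these generate [H] only together with their images
    under powers of [S]. Terminality closes the gap: the morphism from the model
    with representation [p S S] commutes with [S], so it is the identity. *)
Lemma minimal_rep_antipode2 x : p (S (S x)) = p x.
Proof.
have pSS : representation (p \o (S \o S)).
  exact: alg_morphism_comp (model_repP M) (antipode2_alg H).
have uE : (idfun ⊗ (p \o (S \o S)))%tens v = u.
  rewrite -[RHS](modelP M); apply: transpose_inverse_antipode2.
  - exact: model_corepP.
  - exact: model_repP.
  - by rewrite (modelP M).
pose M' := Model (model_corepP M) pSS uE.
have [f [[fH fv fp] _]] := minM.2 M' genH.
have [fA _ _ _] := fH.
have fid y : f y = y.
  apply: (generated_hopf_ind (P := [set y | f y = y]%classic) genH).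
    exact: (equalizer_subalgebra fA (alg_morphism_id H)).
  move=> n _ [phi lphi ->] /=; rewrite (hopf_morphism_iter fH).
  rewrite -(coefficient_map fH _ lphi).
  by rewrite [(idfun ⊗ f)%tens _]fv.
by rewrite -[LHS]/((p \o (S \o S)) x) -[in RHS](fid x); apply: fp.
Qed.

(** Terminality maps the involutive quotient of [H] back onto [H]. *)
Lemma minimal_antipode2 x : S (S x) = x.
Proof.
have qH := involutive_proj_hopf H; set q := proj _ in qH.
have pA := model_repP M; have [lp _ _] := pA.
have [[lq _ _] _ _ _] := qH.
have pJ := involutive_ideal_kernel pA minimal_rep_antipode2.
pose pQ := quot_lift p : involutive_quotient H -> endo W.
have pQA : representation pQ by exact: quot_lift_alg.
pose vQ : (endo V ⊗ involutive_quotient H)%type := (idfun ⊗ q)%tens v.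
have uE : (idfun ⊗ pQ)%tens vQ = u.
  have [lpQ _ _] := pQA; have lid := @linear_idfun k (endo V).
  rewrite /vQ tensor_map_comp // -[RHS](modelP M); congr ((idfun ⊗ _)%tens _).
  by apply/funext => z; apply: quot_lift_proj.
pose M' := Model (corepresentation_map qH (model_corepP M)) pQA uE.
have genQ : left_faithful M'.
  by apply: (generated_hopf_map qH) genH => y; apply: proj_surj.
have [f [[fH fv _] _]] := minM.2 M' genQ.
have [[lf f1 fM] _ _ fS] := fH.
(* the range of [f] is a subalgebra containing all [S^n] of coefficients *)
have [y ->] : exists y, x = f y.
  apply: (generated_hopf_ind (P := [set x | exists y, x = f y]%classic) genH).
    split=> [|a _ _ [y ->] [z ->]|_ _ [y ->] [z ->]].
    - by exists 1; rewrite f1.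
    - by exists (a *: y + z); rewrite lf.
    - by exists (y * z); rewrite fM.
  move=> n _ [phi lphi ->] /=.
  exists (iter n (@antipode k _)
    (tensor_unitl ((phi ⊗ idfun)%tens (model_corep M')))).
  by rewrite (hopf_morphism_iter fH) -(coefficient_map fH _ lphi) fv.
by rewrite !fS involutive_quotientP.
Qed.

End MinimalModel.

Theorem proposition2p1 (k : fieldType) (V W : vectType k) :
  (forall (H : hopfAlgType k) (v : (endo V ⊗ H)%type) (pi : H -> endo W),
     (forall x : H, antipode (antipode x) = x) ->
     corepresentation v -> representation pi ->
     transpose_inverse ((idfun ⊗ pi)%tens v))
  /\
  (forall u : (endo V ⊗ endo W)%type,
     transpose_inverse u ->
     forall M : model u, minimal_model M ->
     forall x : model_hopf M, antipode (antipode x) = x).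
Proof.
split=> [H v pi SS vP piA|u tu M minM x]; last exact: minimal_antipode2.
have [lpi _ _] := piA.
have lS := @antipode_linear k H; have lt := @transpose_linear k V.
have lid U := @linear_idfun k U.
have inv := corep_inverse vP piA.
have := is_inverse_sym (transpose_corep_inverse vP piA).
have -> : pi \o @antipode k H \o @antipode k H = pi.
  by apply/funext => z /=; rewrite SS.
move=> tinv; split.
- by eexists; apply: inv.
- by rewrite tensor_map_comp //; eexists; apply: tinv.
rewrite (inverseE inv) !tensor_map_comp //; last exact: linear_comp.
by apply/esym/inverseE.
Qed.
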